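(* Let $R>0$ be real, let $m\in\mathbb{N}=\{0,1,2,\dots\}$, and put $\lambda_m=m(m+2R+1)$. The problem $$\frac{d^2}{dx^2}\left(x^2e^{-x}\frac{d^2y}{dx^2}\right)-\frac{d}{dx}\left(\big([2R+2]x+2\big)e^{-x}\frac{dy}{dx}\right)=e^{-x}\lambda_m y,\qquad 0\le x<\infty,$$ $$y(0)=R,\qquad y'(0)=\frac{\lambda_m\,y(0)}{-2R}=-\frac{\lambda_m}{2},$$ has the solution $$y_m(x)=-L_0(x)-L_1(x)-L_2(x)-\cdots-L_{m-1}(x)+(R+m)L_m(x),\qquad 0\le x<\infty$$ (for $m=0$ this reads $y_0(x)=R\,L_0(x)$).
   Context: For each integer $n\ge 0$, $L_n$ denotes the Laguerre polynomial of order zero and degree $n$, $$L_n(x)=\sum_{k=0}^{n}(-1)^k\frac{n!}{(n-k)!\,(k!)^2}x^k .$$ *)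

(* Defs.v *)
From Stdlib Require Import Reals Factorial.
From Coquelicot Require Import Coquelicot.
Open Scope R_scope.

Definition Laguerre (n : nat) (x : R) : R :=
  sum_n (fun k => (-1) ^ k * (INR (fact n) / (INR (fact (n - k)) * INR (fact k) ^ 2)) * x ^ k) n.

(* Coquelicot's [is_derive f x l] with the filter [locally x] replaced by its
   trace on [0, +oo): the usual derivative for x > 0, the right derivative at
   x = 0.  Values of [f] on the negative axis play no role. *)
Definition is_derive_nonneg (f : R -> R) (x l : R) : Prop :=
  filterdiff (K := R_AbsRing) (U := R_NormedModule) (V := R_NormedModule)
    f (within (fun t => 0 <= t) (locally x)) (fun h => scal h l).

Definition derivative_on_nonneg (f f' : R -> R) : Prop :=
  forall x : R, 0 <= x -> is_derive_nonneg f x (f' x).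

(* The derivatives occurring in the equation are exhibited as functions, so
   that their existence on [0, +oo) is part of being a solution:
   [p], [p'], [p''] are x^2 e^{-x} y'' and its first two derivatives,
   [q], [q'] are ((2r+2)x+2) e^{-x} y' and its derivative. *)
Definition solves_problem (r lam : R) (y : R -> R) : Prop :=
  exists y' y'' p' p'' q' : R -> R,
    let p := fun x => x ^ 2 * exp (- x) * y'' x in
    let q := fun x => ((2 * r + 2) * x + 2) * exp (- x) * y' x in
    derivative_on_nonneg y y' /\
    derivative_on_nonneg y' y'' /\
    derivative_on_nonneg p p' /\
    derivative_on_nonneg p' p'' /\
    derivative_on_nonneg q q' /\
    (forall x : R, 0 <= x -> p'' x - q' x = exp (- x) * lam * y x) /\
    y 0 = r /\
    y' 0 = lam * y 0 / (- 2 * r) /\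
    lam * y 0 / (- 2 * r) = - (lam / 2).

Definition eigenvalue (r : R) (m : nat) : R := INR m * (INR m + 2 * r + 1).

(* L_0 + ... + L_{m-1} is indexed from 1 to m, which makes it empty for m = 0. *)
Definition eigenfunction (r : R) (m : nat) (x : R) : R :=
  - sum_n_m (fun j => Laguerre (j - 1) x) 1 m + (r + INR m) * Laguerre m x.

(* Main.v *)
(** Write L for L_m.  Since L' = - (L_0 + ... + L_{m-1}), the eigenfunction is
    y = L' + (r + m) L.  Differentiating Laguerre's equation
    x L'' + (1 - x) L' + m L = 0 repeatedly gives one linear relation E_k between
    L^(k), L^(k+1), L^(k+2) for each k, and the fourth-order equation for y is
    the combination x E_3 + (s-1) x E_2 + (m - s - s x) E_1 - s (2s - m + 1) E_0
    of these, where s = r + m.  The boundary values come from E_0 and E_1 at 0. *)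

Require Import Defs.
From Stdlib Require Import Reals Lra Lia Factorial.
From Coquelicot Require Import Coquelicot.
Open Scope R_scope.

(** The trace of [locally x] on the half-line is a finer filter, so the little-o estimate passes to
    it. *)
Lemma is_derive_is_derive_nonneg (f : R -> R) (x l : R) :
  0 <= x -> is_derive f x l -> is_derive_nonneg f x l.
Proof.
intros Hx [Hlin Hd]; split; [exact Hlin|].
intros x0 Hlim.
(* Since [0 <= x], every set of the trace filter contains [x], so no other point can be a limit of
   it. *)
assert (E : x0 = x).
{ destruct (Req_dec x0 x) as [E|N]; [exact E|exfalso].
  assert (He : 0 < Rabs (x - x0)) by (apply Rabs_pos_lt; lra).
  pose proof (locally_singleton _ _
    (Hlim _ (locally_ball x0 (mkposreal _ He))) Hx) as HB.
  unfold ball in HB; simpl in HB.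
  unfold AbsRing_ball, abs, minus, plus, opp in HB; simpl in HB.
  unfold Rminus in HB; lra. }
subst x0; intros eps.
apply filter_le_within.
apply (Hd x (fun P HP => HP) eps).
Qed.

Definition poly (a : nat -> R) (N : nat) (x : R) : R :=
  sum_n (fun i => a i * x ^ i) N.

Lemma poly_S (a : nat -> R) (N : nat) (x : R) :
  poly a (S N) x = poly a N x + a (S N) * x ^ S N.
Proof. unfold poly; rewrite sum_Sn; reflexivity. Qed.

Lemma poly_O (a : nat -> R) (x : R) : poly a 0 x = a 0%nat.
Proof. unfold poly; rewrite sum_O; simpl; ring. Qed.

Lemma poly_ext (a b : nat -> R) (N : nat) (x : R) :
  (forall i, (i <= N)%nat -> a i = b i) -> poly a N x = poly b N x.
Proof.
intros H; apply sum_n_ext_loc; intros i Hi; rewrite (H i Hi); reflexivity.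
Qed.

Lemma poly_minus (a b : nat -> R) (N : nat) (x : R) :
  poly (fun i => a i - b i) N x = poly a N x - poly b N x.
Proof.
induction N as [|N IH]; [rewrite !poly_O|rewrite !poly_S, IH]; ring.
Qed.

Lemma poly_at_0 (a : nat -> R) (N : nat) : poly a N 0 = a 0%nat.
Proof.
induction N as [|N IH]; [apply poly_O|rewrite poly_S, IH; simpl; ring].
Qed.

Lemma is_derive_poly_S (a : nat -> R) (N : nat) (x : R) :
  is_derive (poly a (S N)) x (poly (PS_derive a) N x).
Proof.
induction N as [|N IH].
- apply is_derive_ext with (fun t => a 0%nat + a 1%nat * t).
  + intros t; rewrite poly_S, poly_O; simpl; ring.
  + rewrite poly_O; unfold PS_derive; auto_derive; [easy|simpl; ring].
- apply is_derive_ext with (fun t => poly a (S N) t + a (S (S N)) * t ^ S (S N)).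
  + intros t; rewrite (poly_S a (S N)); reflexivity.
  + rewrite (poly_S _ N).
    apply (is_derive_plus (V := R_NormedModule) (poly a (S N))); [exact IH|].
    unfold PS_derive; auto_derive; [easy|].
    rewrite !S_INR, <- tech_pow_Rmult; destruct N; simpl; ring.
Qed.

(** Once the coefficient after the last vanishes, the summation bound can stay [N] through every
    further differentiation. *)
Lemma is_derive_poly (a : nat -> R) (N : nat) (x : R) :
  a (S N) = 0 -> is_derive (poly a N) x (poly (PS_derive a) N x).
Proof.
intros H; apply is_derive_ext with (poly a (S N)).
- intros t; rewrite poly_S, H; simpl; ring.
- apply is_derive_poly_S.
Qed.

Lemma PS_derive_iter_0 (a : nat -> R) (N k : nat) :
  (forall i, (N < i)%nat -> a i = 0) ->
  forall i, (N < i)%nat -> Nat.iter k PS_derive a i = 0.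
Proof.
intros H; induction k as [|k IH]; intros i Hi; simpl; [auto|].
unfold PS_derive; rewrite IH by lia; ring.
Qed.

(* The coefficient of x^k in L_n, through the recurrence equivalent to Laguerre's
   equation; unlike the closed form with the truncated n - k, it vanishes for k > n. *)
Fixpoint laguerre_coef (n k : nat) : R :=
  match k with
  | O => 1
  | S k' => (INR k' - INR n) / INR (S k') ^ 2 * laguerre_coef n k'
  end.

Lemma laguerre_coef_S (n k : nat) :
  INR (S k) ^ 2 * laguerre_coef n (S k) = (INR k - INR n) * laguerre_coef n k.
Proof. cbn [laguerre_coef]; field; apply not_0_INR; lia. Qed.

Lemma laguerre_coef_gt (n k : nat) : (n < k)%nat -> laguerre_coef n k = 0.
Proof.
induction 1 as [|k _ IH]; cbn [laguerre_coef].
- unfold Rdiv; ring.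
- rewrite IH; ring.
Qed.

Lemma laguerre_coef_closed (n k : nat) : (k <= n)%nat ->
  laguerre_coef n k =
  (-1) ^ k * (INR (fact n) / (INR (fact (n - k)) * INR (fact k) ^ 2)).
Proof.
induction k as [|k IH]; intros Hk.
- rewrite Nat.sub_0_r; simpl; field; apply INR_fact_neq_0.
- cbn [laguerre_coef]; rewrite IH by lia.
  replace (n - k)%nat with (S (n - S k)) by lia.
  rewrite !fact_simpl, !mult_INR.
  replace (INR (S (n - S k))) with (INR n - INR k)
    by (rewrite <- minus_INR by lia; f_equal; lia).
  assert (INR k < INR n) by (apply lt_INR; lia).
  simpl pow; field; repeat split;
    solve [apply INR_fact_neq_0 | apply (not_0_INR (S k)); lia | lra].
Qed.

Lemma Laguerre_poly (n : nat) (x : R) : Laguerre n x = poly (laguerre_coef n) n x.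
Proof.
apply sum_n_ext_loc; intros k Hk; rewrite laguerre_coef_closed by exact Hk.
reflexivity.
Qed.

(** The coefficients are (-1)^k binom(n,k)/k!, and this is the ratio of binom(n+1,k) to binom(n,k),
    multiplied out so that it also covers k > n. *)
Lemma laguerre_coef_degree_S (n k : nat) :
  (INR n + 1 - INR k) * laguerre_coef (S n) k = (INR n + 1) * laguerre_coef n k.
Proof.
induction k as [|k IH]; [simpl; ring|].
cbn [laguerre_coef]; rewrite !S_INR.
assert (INR k + 1 <> 0) by (pose proof (pos_INR k); lra).
replace ((INR n + 1 - (INR k + 1)) *
  ((INR k - (INR n + 1)) / (INR k + 1) ^ 2 * laguerre_coef (S n) k))
  with ((INR k - INR n) / (INR k + 1) ^ 2 *
        ((INR n + 1 - INR k) * laguerre_coef (S n) k)) by (field; assumption).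
rewrite IH; field; assumption.
Qed.

(** Coefficient form of L_{n+1}' = L_n' - L_n, which telescopes to L_n' = -(L_0 + ... + L_{n-1}). *)
Lemma PS_derive_laguerre_coef_S (n k : nat) :
  PS_derive (laguerre_coef (S n)) k =
  PS_derive (laguerre_coef n) k - laguerre_coef n k.
Proof.
unfold PS_derive; cbn [laguerre_coef].
assert (H := laguerre_coef_degree_S n k).
rewrite !S_INR.
assert (INR k + 1 <> 0) by (pose proof (pos_INR k); lra).
replace ((INR k + 1) *
  ((INR k - (INR n + 1)) / (INR k + 1) ^ 2 * laguerre_coef (S n) k))
  with (- ((INR n + 1 - INR k) * laguerre_coef (S n) k) / (INR k + 1))
  by (field; assumption).
rewrite H; field; assumption.
Qed.

Definition laguerre_deriv (n k : nat) (x : R) : R :=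
  poly (Nat.iter k PS_derive (laguerre_coef n)) n x.

Lemma is_derive_laguerre_deriv (n k : nat) (x : R) :
  is_derive (laguerre_deriv n k) x (laguerre_deriv n (S k) x).
Proof.
apply is_derive_poly, (PS_derive_iter_0 _ n); [apply laguerre_coef_gt|lia].
Qed.

Lemma Derive_laguerre_deriv (n k : nat) (x : R) :
  Derive (fun t => laguerre_deriv n k t) x = laguerre_deriv n (S k) x.
Proof. apply is_derive_unique, is_derive_laguerre_deriv. Qed.

Lemma laguerre_deriv_1 (n : nat) (x : R) :
  laguerre_deriv n 1 x = - sum_n_m (fun j => Laguerre (j - 1) x) 1 n.
Proof.
induction n as [|n IH].
- rewrite sum_n_m_zero by lia; unfold laguerre_deriv; rewrite poly_O.
  unfold zero, PS_derive; simpl; unfold Rdiv; ring.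
- rewrite sum_n_Sm by lia.
  change (plus ?a ?b) with (a + b).
  replace (S n - 1)%nat with n by lia.
  rewrite Ropp_plus_distr, <- IH, Laguerre_poly.
  unfold laguerre_deriv; simpl Nat.iter.
  rewrite (poly_ext _ _ (S n) x (fun i _ => PS_derive_laguerre_coef_S n i)).
  rewrite poly_minus, !poly_S.
  (* The sums run one term past the bound [n]; the extra terms carry coefficients of L_n of index
     n+1 and n+2, which are zero. *)
  unfold PS_derive at 2.
  rewrite !laguerre_coef_gt by lia; ring.
Qed.

Lemma laguerre_equation (n : nat) (x : R) :
  x * laguerre_deriv n 2 x + (1 - x) * laguerre_deriv n 1 x
  + INR n * laguerre_deriv n 0 x = 0.
Proof.
unfold laguerre_deriv; simpl Nat.iter.
(* The partial sums up to N leave only the boundary term in x^(N+1),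
   which vanishes at N = n. *)
assert (H : forall N,
  x * poly (PS_derive (PS_derive (laguerre_coef n))) N x
  + (1 - x) * poly (PS_derive (laguerre_coef n)) N x
  + INR n * poly (laguerre_coef n) N x
  = INR (S N) * (INR (S (S N)) * laguerre_coef n (S (S N)) - laguerre_coef n (S N))
    * x ^ S N).
{ induction N as [|N IH].
  - rewrite !poly_O; unfold PS_derive.
    pose proof (laguerre_coef_S n 0) as H0; simpl in H0 |- *.
    lra.
  - rewrite !poly_S.
    assert (H1 := laguerre_coef_S n (S N)).
    set (A := poly (PS_derive (PS_derive (laguerre_coef n))) N x) in *.
    set (B := poly (PS_derive (laguerre_coef n)) N x) in *.
    set (D := poly (laguerre_coef n) N x) in *.
    unfold PS_derive.
    (* The defect at N+1 is the defect at N plus x^(N+1) times the coefficient recurrence at N+1. *)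
    apply Rminus_diag_uniq.
    transitivity ((x * A + (1 - x) * B + INR n * D
      - INR (S N) * (INR (S (S N)) * laguerre_coef n (S (S N)) - laguerre_coef n (S N)) * x ^ S N)
      + (INR (S (S N)) ^ 2 * laguerre_coef n (S (S N)) - (INR (S N) - INR n) * laguerre_coef n (S N)) * x ^ S N).
    + rewrite !S_INR, <- !tech_pow_Rmult. ring.
    + rewrite IH, H1; ring. }
rewrite H, !laguerre_coef_gt by lia; ring.
Qed.

Lemma laguerre_deriv_equation (n k : nat) (x : R) :
  x * laguerre_deriv n (S (S k)) x
  + (INR k + 1 - x) * laguerre_deriv n (S k) x
  + (INR n - INR k) * laguerre_deriv n k x = 0.
Proof.
revert x; induction k as [|k IH]; intros x.
- rewrite <- (laguerre_equation n x); simpl; ring.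
(* By induction the left side of E_k is the zero function; its derivative is the left side of
   E_{k+1}. *)
- assert (HD : is_derive (fun _ : R => 0) x
    (x * laguerre_deriv n (S (S (S k))) x
     + (INR (S k) + 1 - x) * laguerre_deriv n (S (S k)) x
     + (INR n - INR (S k)) * laguerre_deriv n (S k) x)).
  { eapply is_derive_ext; [exact IH|].
    auto_derive;
      [repeat split; eexists; apply is_derive_laguerre_deriv|].
    rewrite !Derive_laguerre_deriv, S_INR; ring. }
  rewrite <- (is_derive_unique _ _ _ HD); apply Derive_const.
Qed.

Lemma laguerre_deriv_at_0 (n : nat) : laguerre_deriv n 0 0 = 1.
Proof. unfold laguerre_deriv; rewrite poly_at_0; reflexivity. Qed.

Lemma eigenfunction_laguerre_deriv (r : R) (m : nat) (x : R) :
  eigenfunction r m x = laguerre_deriv m 1 x + (r + INR m) * laguerre_deriv m 0 x.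
Proof.
unfold eigenfunction; rewrite laguerre_deriv_1, Laguerre_poly; reflexivity.
Qed.

Theorem theorem2 (r : R) (hr : 0 < r) (m : nat) :
  solves_problem r (eigenvalue r m) (eigenfunction r m).
Proof.
set (s := r + INR m).
(* [Y k] is the k-th derivative of y = L' + s L. *)
set (Y := fun k x => laguerre_deriv m (S k) x + s * laguerre_deriv m k x).
assert (HY : forall k x, is_derive (Y k) x (Y (S k) x)).
{ intros k x; apply (is_derive_plus (V := R_NormedModule)).
  - apply is_derive_laguerre_deriv.
  - apply is_derive_scal, is_derive_laguerre_deriv. }
assert (HE : forall k x, ex_derive (Y k) x) by (intros; eexists; apply HY).
assert (HU : forall k x, Derive (fun t => Y k t) x = Y (S k) x)
  by (intros; apply is_derive_unique, HY).
assert (HD : forall f f' : R -> R,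
  (forall x, is_derive f x (f' x)) -> derivative_on_nonneg f f').
{ intros f f' H x Hx; apply is_derive_is_derive_nonneg; auto. }
assert (E0 := laguerre_deriv_equation m 0).
assert (E1 := laguerre_deriv_equation m 1).
assert (E2 := laguerre_deriv_equation m 2).
assert (E3 := laguerre_deriv_equation m 3).
(* E_0 at 0 gives L'(0) = -m, hence y(0) = -m + (r + m). *)
assert (Hy0 : eigenfunction r m 0 = r).
{ rewrite eigenfunction_laguerre_deriv.
  specialize (E0 0); rewrite laguerre_deriv_at_0 in *; simpl in E0; lra. }
(* The last three witnesses come from the product rule with exp(-x) factored out. *)
exists (Y 1%nat), (Y 2%nat),
  (fun x => exp (- x) * (x ^ 2 * Y 3%nat x + (2 * x - x ^ 2) * Y 2%nat x)),
  (fun x => exp (- x) * (x ^ 2 * Y 4%nat x + (4 * x - 2 * x ^ 2) * Y 3%nat x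
                         + (x ^ 2 - 4 * x + 2) * Y 2%nat x)),
  (fun x => exp (- x) * (((2 * r + 2) * x + 2) * (Y 2%nat x - Y 1%nat x)
                         + (2 * r + 2) * Y 1%nat x)).
refine (conj _ (conj _ (conj _ (conj _ (conj _ (conj _ (conj _ (conj _ _)))))))); cbv zeta.
- apply HD; intros x; apply is_derive_ext with (Y 0%nat); [|apply HY].
  intros t; symmetry; apply eigenfunction_laguerre_deriv.
- apply HD, HY.
- apply HD; intros x; auto_derive; [apply HE|rewrite HU; ring].
- apply HD; intros x; auto_derive; [repeat split; apply HE|rewrite !HU; ring].
- apply HD; intros x; auto_derive; [apply HE|rewrite HU; ring].
- intros x _; rewrite eigenfunction_laguerre_deriv; unfold Y, eigenvalue; fold s.
  (* With r eliminated, the combination of the E_k is an identity that [ring] checks in s, m, x,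
     exp(-x) and the derivatives of L. *)
  replace r with (s - INR m) by (unfold s; ring).
  specialize (E0 x); specialize (E1 x); specialize (E2 x); specialize (E3 x).
  simpl INR in E0, E1, E2, E3.
  apply Rminus_diag_uniq.
  match type of E0 with ?e0 = 0 => match type of E1 with ?e1 = 0 =>
  match type of E2 with ?e2 = 0 => match type of E3 with ?e3 = 0 =>
  transitivity (exp (- x) * (x * e3 + (s - 1) * x * e2
    + (INR m - s - s * x) * e1 - s * (2 * s - INR m + 1) * e0)); [ring|]
  end end end end.
  rewrite E0, E1, E2, E3; ring.
- exact Hy0.
- rewrite Hy0; unfold Y, eigenvalue.
  (* E_1 at 0 gives L''(0) = m(m-1)/2, so y'(0) = m(m-1)/2 - (r + m)m = -m(m + 2r + 1)/2. *)
  specialize (E0 0); specialize (E1 0); rewrite laguerre_deriv_at_0 in E0.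
  simpl INR in E0, E1.
  assert (F1 : laguerre_deriv m 1 0 = - INR m) by lra.
  rewrite F1 in *.
  replace (laguerre_deriv m 2 0) with (INR m * (INR m - 1) / 2) by lra.
  unfold s; field; lra.
- rewrite Hy0; field; lra.
Qed.
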